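(* Let $T\in(0,\infty)$, $\varrho_0>0$, let $\tau:[0,\infty)\to(0,\infty)$ be continuous and decreasing, and let $\rho(t)=\exp\left(-\int_0^t\frac{1}{\tau(s)}\,ds\right)$. Let $\ell:[0,\infty)\to\mathbb{R}$ be a continuous function satisfying $\operatorname{supp}(\ell)=[0,T]$ and $\int_0^T\frac{\ell(s)}{\rho(s)}\,ds=1$. Then the solution $\varrho$ of $$\tau\,\varrho'+\varrho=-\tau\,\varrho_0\,\ell\ \text{ on }(0,\infty),\qquad \varrho(0)=\varrho_0,$$ is $C^1$ on $(0,\infty)$ and is given by $$\varrho(t)=\varrho_0\,\rho(t)\left[1-\int_0^t\frac{\ell(s)}{\rho(s)}\,ds\right]\qquad\text{for } t\in[0,T].$$ If in addition $\ell$ is monotonically decreasing on $(0,T)$ and $\tau$ is such that $\tau^{-1}\rho$ is monotonically decreasing on $(0,T)$, then the kinetic energy of the process $\varrho$ is decreasing on $(0,T)$ and vanishes at $t=T$.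
   Context: $\rho$ and $\varrho$ are different functions. The kinetic energy of a process $\varrho$ is $E_{kin}(t)=c\,(\varrho'(t))^2$ with a positive proportionality constant $c$; its vanishing at $t=T$ means $\lim_{t\to T-}E_{kin}(t)=0$. *)

(* Defs.v *)
From Stdlib Require Export Reals.
From Coquelicot Require Export Coquelicot.

Open Scope R_scope.

(* A function on [0,oo) is represented by a total function R -> R of which only
   the values at nonnegative arguments are ever constrained or used. *)
Definition nonneg_half_line (t : R) : Prop := 0 <= t.

Definition nonincreasing_on (D : R -> Prop) (f : R -> R) : Prop :=
  forall s t : R, D s -> D t -> s <= t -> f t <= f s.

Definition strictly_decreasing_on (D : R -> Prop) (f : R -> R) : Prop :=
  forall s t : R, D s -> D t -> s < t -> f t < f s.

(* The support, as a function on [0,oo): since [0,oo) is closed, the closure in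
   [0,oo) is the closure in R. *)
Definition support (f : R -> R) : R -> Prop :=
  adherence (fun t => nonneg_half_line t /\ f t <> 0).

Definition relaxation (tau : R -> R) (t : R) : R :=
  exp (- RInt (fun s => 1 / tau s) 0 t).

(* Classical solution of tau y' + y = - tau y0 l on (0,oo), y(0) = y0.
   Continuity on [0,oo) ties the initial value to the values on (0,oo). *)
Definition is_solution (tau l : R -> R) (y0 : R) (y : R -> R) : Prop :=
  continuous_on nonneg_half_line y /\
  (forall t : R, 0 < t ->
     ex_derive y t /\ tau t * Derive y t + y t = - tau t * y0 * l t) /\
  y 0 = y0.

Definition C1_on_positive (y : R -> R) : Prop :=
  forall t : R, 0 < t -> ex_derive y t /\ continuous (Derive y) t.

Definition kinetic_energy (c : R) (y : R -> R) (t : R) : R :=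
  c * (Derive y t) ^ 2.

(* Main.v *)
Require Import Defs.
From Stdlib Require Import Reals Lra.
From Coquelicot Require Import Coquelicot.

(** The function [exp (int_0^t 1/tau)] is an integrating factor.  Dividing the
    equation by [tau] and by the relaxation function [rho], which satisfies
    [rho' = - rho / tau], turns it into [(y / rho)' = - y0 l / rho]
    ([solution_over_relaxation_const]).  A continuous function on the closed
    half line whose derivative vanishes inside is constant, so a solution is
    determined by its initial value and must be the variation of constants
    formula; conversely that formula is differentiated directly
    ([explicit_solution_correct]).  The equation then writes the derivative
    in terms of continuous functions, whence the [C^1] claim.

    For the energy, the formula gives on [(0,T)]
<<
      - y' = y0 * (l + (rho / tau) * (1 - int_0^t l / rho)).
>>
    A continuous [l] with support [[0,T]] vanishes at [T]; being nonincreasing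
    it is then nonnegative before [T], and it cannot vanish at an interior
    point, as it would be zero from there on and its support would be shorter
    ([pos_of_nonincreasing_support]).  Hence the last factor decreases strictly
    to its value [0] at [T] and is positive before.  So [- y'] is a sum of a
    nonincreasing function and a product of a positive nonincreasing function
    with a positive strictly decreasing one: it is positive and strictly
    decreasing, and its square, the energy, is strictly decreasing as well.
    At [T] both terms vanish, and continuity of [y'] gives the limit. *)

(** * Continuity and primitives on the closed half line *)

Lemma continuous_Rmax0 (t : R) : continuous (fun s => Rmax 0 s) t.
Proof.
apply continuous_ext with (fun s => / 2 * (s + Rabs s)).
- intros s; unfold Rmax, Rabs.
  destruct (Rle_dec 0 s); destruct (Rcase_abs s); lra.
- apply (continuous_mult (K := R_AbsRing) (fun _ => / 2));
    [apply continuous_const|].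
  apply (continuous_plus (V := R_NormedModule) (fun s => s));
    [apply continuous_id|].
  apply continuous_Rabs.
Qed.

(** One-sided continuity at [0] is awkward for the integration and
    differentiation lemmas, which want two-sided continuity.  Extending a
    function by its value at [0] reduces to that case. *)
Lemma continuous_on_half_line_iff (f : R -> R) :
  continuous_on nonneg_half_line f <->
  (forall t, continuous (fun s => f (Rmax 0 s)) t).
Proof.
split.
- intros Hf t.
  apply (filterlim_comp _ _ _ (fun s => Rmax 0 s) f _
           (within nonneg_half_line (locally (Rmax 0 t)))).
  + intros P HP; change (locally t (fun s => P (Rmax 0 s))).
    apply (filter_imp (fun s => nonneg_half_line (Rmax 0 s) -> P (Rmax 0 s))).
    * intros s H; apply H; apply Rmax_l.
    * exact (continuous_Rmax0 t _ HP).
  + apply Hf, Rmax_l.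
- intros Hf t Ht.
  apply filterlim_within_ext with (fun s => f (Rmax 0 s)).
  + intros s Hs; rewrite Rmax_right; auto.
  + apply (filterlim_filter_le_1 (F := locally t)).
    * apply filter_le_within.
    * rewrite <- (Rmax_right 0 t Ht) at 2; apply Hf.
Qed.

Lemma locally_pos_Rmax0 (t : R) : 0 < t -> locally t (fun s => Rmax 0 s = s).
Proof.
intros Ht; apply (filter_imp (fun s => 0 < s)).
- intros s Hs; apply Rmax_right; lra.
- exact (open_gt 0 t Ht).
Qed.

Lemma continuous_of_half_line (f : R -> R) (t : R) :
  continuous_on nonneg_half_line f -> 0 < t -> continuous f t.
Proof.
intros Hf Ht.
apply continuous_ext_loc with (fun s => f (Rmax 0 s)).
- apply (filter_imp (fun s => Rmax 0 s = s)).
  + intros s ->; reflexivity.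
  + now apply locally_pos_Rmax0.
- now apply continuous_on_half_line_iff.
Qed.

Lemma continuous_on_inv_half_line (f : R -> R) :
  (forall t, 0 <= t -> 0 < f t) -> continuous_on nonneg_half_line f ->
  continuous_on nonneg_half_line (fun t => 1 / f t).
Proof.
intros Hpos Hf; apply continuous_on_half_line_iff; intros t.
apply (continuous_ext (fun s => / f (Rmax 0 s))).
- intros s; symmetry; apply Rmult_1_l.
- apply (continuous_comp (fun s => f (Rmax 0 s)) (fun x => / x)).
  + now apply continuous_on_half_line_iff.
  + apply continuous_Rinv, Rgt_not_eq, Hpos, Rmax_l.
Qed.

Lemma continuous_on_mult_half_line (f g : R -> R) :
  continuous_on nonneg_half_line f -> continuous_on nonneg_half_line g ->
  continuous_on nonneg_half_line (fun t => f t * g t).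
Proof.
intros Hf Hg; apply continuous_on_half_line_iff; intros t.
apply (continuous_mult (K := R_AbsRing)
    (fun s => f (Rmax 0 s)) (fun s => g (Rmax 0 s)));
  now apply continuous_on_half_line_iff.
Qed.

Lemma continuous_on_plus_half_line (f g : R -> R) :
  continuous_on nonneg_half_line f -> continuous_on nonneg_half_line g ->
  continuous_on nonneg_half_line (fun t => f t + g t).
Proof.
intros Hf Hg; apply continuous_on_half_line_iff; intros t.
apply (continuous_plus (V := R_NormedModule)
    (fun s => f (Rmax 0 s)) (fun s => g (Rmax 0 s)));
  now apply continuous_on_half_line_iff.
Qed.

Lemma continuous_on_const_half_line (c : R) :
  continuous_on nonneg_half_line (fun _ : R => c).
Proof. intros t _; apply filterlim_const. Qed.

Lemma ex_RInt_half_line (f : R -> R) (a b : R) :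
  continuous_on nonneg_half_line f -> 0 <= a -> 0 <= b -> ex_RInt f a b.
Proof.
intros Hf Ha Hb.
apply ex_RInt_ext with (fun s => f (Rmax 0 s)).
- intros s [Hs _]; rewrite Rmax_right; [reflexivity|].
  pose proof (Rmin_glb a b 0 Ha Hb); lra.
- apply (@ex_RInt_continuous R_CompleteNormedModule).
  intros z _; now apply continuous_on_half_line_iff.
Qed.

Lemma is_derive_RInt_half_line (f : R -> R) (t : R) :
  continuous_on nonneg_half_line f -> 0 < t ->
  is_derive (fun x => RInt f 0 x) t (f t).
Proof.
intros Hf Ht; apply (is_derive_RInt (V := R_NormedModule) f _ 0).
- apply (filter_imp (fun s => 0 < s)); [|exact (open_gt 0 t Ht)].
  intros s Hs; apply (@RInt_correct R_CompleteNormedModule).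
  apply ex_RInt_half_line; auto; lra.
- now apply continuous_of_half_line.
Qed.

Lemma continuous_on_RInt_half_line (f : R -> R) :
  continuous_on nonneg_half_line f ->
  continuous_on nonneg_half_line (fun x => RInt f 0 x).
Proof.
intros Hf; apply continuous_on_half_line_iff; intros t.
assert (Hf' := proj1 (continuous_on_half_line_iff f) Hf).
apply (continuous_ext (fun x => RInt (fun s => f (Rmax 0 s)) 0 (Rmax 0 x))).
- intros x; apply RInt_ext; intros s [Hs _].
  rewrite Rmin_left in Hs by apply Rmax_l.
  rewrite Rmax_right; [reflexivity|lra].
- apply (continuous_comp (fun x => Rmax 0 x)
           (fun x => RInt (fun s => f (Rmax 0 s)) 0 x)).
  + apply continuous_Rmax0.
  + apply (@ex_derive_continuous R_AbsRing R_NormedModule).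
    exists (f (Rmax 0 (Rmax 0 t))).
    apply (is_derive_RInt (V := R_NormedModule) (fun s => f (Rmax 0 s)) _ 0);
      [|apply Hf'].
    apply filter_forall; intros b.
    apply (@RInt_correct R_CompleteNormedModule).
    apply (@ex_RInt_continuous R_CompleteNormedModule); intros z _; apply Hf'.
Qed.

Lemma RInt_lt_of_pos (f : R -> R) (a b : R) :
  continuous_on nonneg_half_line f -> 0 < a < b ->
  (forall s, a < s < b -> 0 < f s) -> RInt f 0 a < RInt f 0 b.
Proof.
intros Hf Hab Hpos.
rewrite <- (@RInt_Chasles R_CompleteNormedModule f 0 a b)
  by (apply ex_RInt_half_line; auto; lra).
change plus with Rplus.
enough (0 < RInt f a b) by lra.
apply RInt_gt_0; [lra|exact Hpos|].
intros s Hs; apply continuous_of_half_line; auto; lra.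
Qed.

Lemma const_of_zero_derive_half_line (w : R -> R) :
  continuous_on nonneg_half_line w ->
  (forall t, 0 < t -> is_derive w t 0) ->
  forall t, 0 <= t -> w t = w 0.
Proof.
intros Hw Hd t Ht.
(* The mean value theorem asks for two-sided continuity at the endpoint [0]. *)
destruct (MVT_gen (fun s => w (Rmax 0 s)) 0 t (fun _ => 0)) as [c [_ Hc]].
- rewrite Rmin_left by exact Ht; intros s [Hs _].
  apply is_derive_ext_loc with w; [|now apply Hd].
  apply (filter_imp (fun x => Rmax 0 x = x)).
  + intros x ->; reflexivity.
  + now apply locally_pos_Rmax0.
- intros s _; apply continuity_pt_filterlim.
  now apply (continuous_on_half_line_iff w).
- rewrite (Rmax_right 0 t Ht), (Rmax_left 0 0) in Hc by lra; lra.
Qed.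

(** * Variation of constants *)

Lemma relaxation_pos (tau : R -> R) (t : R) : 0 < relaxation tau t.
Proof. apply exp_pos. Qed.

Lemma relaxation_0 (tau : R -> R) : relaxation tau 0 = 1.
Proof.
unfold relaxation; rewrite (@RInt_point R_CompleteNormedModule).
change zero with 0; rewrite Ropp_0; apply exp_0.
Qed.

Lemma is_derive_mult_one_minus (k : R) (f g : R -> R) (t df dg : R) :
  is_derive f t df -> is_derive g t dg ->
  is_derive (fun s => k * f s * (1 - g s)) t
    (k * df * (1 - g t) - k * f t * dg).
Proof.
intros Hf Hg; auto_derive.
- split; [now exists df|split; [now exists dg|exact I]].
- rewrite (is_derive_unique (fun x : R => f x) _ _ Hf).
  rewrite (is_derive_unique (fun x : R => g x) _ _ Hg); ring.
Qed.

Lemma is_derive_quotient_plus (k : R) (u f g : R -> R) (t du df dg : R) :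
  f t <> 0 -> is_derive u t du -> is_derive f t df -> is_derive g t dg ->
  is_derive (fun s => u s / f s + k * g s) t
    ((du * f t - u t * df) / f t ^ 2 + k * dg).
Proof.
intros Hft Hu Hf Hg; auto_derive.
- repeat split; auto; eexists; eassumption.
- rewrite (is_derive_unique (fun x : R => u x) _ _ Hu).
  rewrite (is_derive_unique (fun x : R => f x) _ _ Hf).
  rewrite (is_derive_unique (fun x : R => g x) _ _ Hg); field; exact Hft.
Qed.

Definition explicit_solution (tau l : R -> R) (y0 t : R) : R :=
  y0 * relaxation tau t *
  (1 - RInt (fun s => l s / relaxation tau s) 0 t).

Section VariationOfConstants.

Variables tau l : R -> R.
Variable y0 : R.
Hypothesis tau_pos : forall t : R, 0 <= t -> 0 < tau t.
Hypothesis tau_cont : continuous_on nonneg_half_line tau.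
Hypothesis l_cont : continuous_on nonneg_half_line l.

Let rho := relaxation tau.
Let load := fun s => l s / relaxation tau s.

Lemma continuous_on_relaxation : continuous_on nonneg_half_line rho.
Proof.
apply continuous_on_half_line_iff; intros t.
apply continuous_exp_comp.
apply (continuous_opp (V := R_NormedModule)
    (fun s => RInt (fun x => 1 / tau x) 0 (Rmax 0 s))).
apply (continuous_on_half_line_iff (fun s => RInt (fun x => 1 / tau x) 0 s)).
now apply continuous_on_RInt_half_line, continuous_on_inv_half_line.
Qed.

Lemma is_derive_relaxation (t : R) :
  0 < t -> is_derive rho t (- rho t / tau t).
Proof.
intros Ht; unfold rho, relaxation.
replace (- exp (- RInt (fun s => 1 / tau s) 0 t) / tau t)
  with (- (1 / tau t) * exp (- RInt (fun s => 1 / tau s) 0 t))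
  by (unfold Rdiv; ring).
apply (is_derive_comp exp (fun x => - RInt (fun s => 1 / tau s) 0 x)).
- apply is_derive_exp.
- apply (is_derive_opp (V := R_NormedModule) (fun x => RInt _ 0 x)).
  apply (is_derive_RInt_half_line (fun s => 1 / tau s)); [|exact Ht].
  now apply continuous_on_inv_half_line.
Qed.

Lemma continuous_on_load : continuous_on nonneg_half_line load.
Proof.
apply continuous_on_mult_half_line; [exact l_cont|].
assert (H := continuous_on_inv_half_line rho (fun t _ => relaxation_pos tau t)
               continuous_on_relaxation).
intros t Ht; apply filterlim_within_ext with (fun s => 1 / rho s).
- intros s _; unfold Rdiv; apply Rmult_1_l.
- rewrite <- (Rmult_1_l (/ relaxation tau t)); exact (H t Ht).
Qed.

Lemma explicit_solution_correct :
  is_solution tau l y0 (explicit_solution tau l y0).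
Proof.
assert (Hload := continuous_on_load).
split; [|split].
- apply continuous_on_mult_half_line.
  + apply continuous_on_mult_half_line.
    * apply continuous_on_const_half_line.
    * exact continuous_on_relaxation.
  + apply continuous_on_plus_half_line; [apply continuous_on_const_half_line|].
    intros t Ht; apply (filterlim_comp _ _ _ (fun x => RInt load 0 x) Ropp
      _ (locally (RInt load 0 t))).
    * now apply continuous_on_RInt_half_line.
    * apply (continuous_opp (V := R_NormedModule) (fun x => x)).
      apply continuous_id.
- intros t Ht.
  assert (Hd : is_derive (explicit_solution tau l y0) t
            (- (explicit_solution tau l y0 t) / tau t - y0 * l t)).
  { assert (H1 := is_derive_relaxation t Ht).
    assert (H2 := is_derive_RInt_half_line load t Hload Ht).
    assert (H := is_derive_mult_one_minus y0 _ _ _ _ _ H1 H2).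
    replace (- (explicit_solution tau l y0 t) / tau t - y0 * l t)
      with (y0 * (- rho t / tau t) * (1 - RInt load 0 t)
            - y0 * rho t * load t); [exact H|].
    unfold explicit_solution, rho, load; field.
    split; apply Rgt_not_eq; [apply tau_pos; lra|apply relaxation_pos]. }
  split; [eexists; exact Hd|].
  rewrite (is_derive_unique _ _ _ Hd).
  field; apply Rgt_not_eq, tau_pos; lra.
- unfold explicit_solution.
  rewrite relaxation_0, (@RInt_point R_CompleteNormedModule).
  change zero with 0; ring.
Qed.

Lemma Derive_solution (y : R -> R) (t : R) :
  is_solution tau l y0 y -> 0 < t ->
  Derive y t = - (y0 * l t + y t / tau t).
Proof.
intros [_ [Hode _]] Ht; destruct (Hode t Ht) as [_ Heq].
assert (Htau : tau t <> 0) by (apply Rgt_not_eq, tau_pos; lra).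
apply (Rmult_eq_reg_l (tau t)); [|exact Htau].
transitivity (- y t - tau t * y0 * l t); [lra|field; exact Htau].
Qed.

(** The integrating factor: the equation says exactly that this combination
    has zero derivative. *)
Lemma solution_over_relaxation_const (y : R -> R) (t : R) :
  is_solution tau l y0 y -> 0 <= t ->
  y t / rho t + y0 * RInt load 0 t = y0.
Proof.
intros Hsol; pose proof Hsol as [Hc [Hode H0]].
assert (Hload := continuous_on_load).
assert (E : y 0 / rho 0 + y0 * RInt load 0 0 = y0).
{ unfold rho; rewrite relaxation_0, H0, (@RInt_point R_CompleteNormedModule).
  change zero with 0; field. }
intros Ht; rewrite <- E at 2; revert t Ht.
apply (const_of_zero_derive_half_line
         (fun t => y t / rho t + y0 * RInt load 0 t)).
- apply continuous_on_plus_half_line; apply continuous_on_mult_half_line.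
  + exact Hc.
  + intros t Ht; apply (filterlim_comp _ _ _ rho Rinv _ (locally (rho t))).
    * now apply continuous_on_relaxation.
    * apply continuous_Rinv, Rgt_not_eq, relaxation_pos.
  + apply continuous_on_const_half_line.
  + now apply continuous_on_RInt_half_line.
- intros t Ht; destruct (Hode t Ht) as [Hy _].
  assert (H1 := is_derive_relaxation t Ht).
  assert (H2 := is_derive_RInt_half_line load t Hload Ht).
  assert (Hrho : rho t <> 0) by apply Rgt_not_eq, relaxation_pos.
  assert (Htau : tau t <> 0) by (apply Rgt_not_eq, tau_pos; lra).
  assert (H := is_derive_quotient_plus y0 y _ _ _ _ _ _ Hrho
                 (Derive_correct y t Hy) H1 H2).
  match type of H with is_derive _ _ ?d => replace d with 0 in H end;
    [exact H|symmetry].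
  rewrite (Derive_solution y t Hsol Ht).
  unfold load; change (relaxation tau t) with (rho t); field; auto.
Qed.

Lemma solution_eq_explicit (y : R -> R) (t : R) :
  is_solution tau l y0 y -> 0 <= t -> y t = explicit_solution tau l y0 t.
Proof.
intros Hy Ht.
assert (H := solution_over_relaxation_const y t Hy Ht).
assert (Hrho : rho t <> 0) by apply Rgt_not_eq, relaxation_pos.
change (explicit_solution tau l y0 t) with (y0 * rho t * (1 - RInt load 0 t)).
transitivity (rho t * (y t / rho t)); [field; exact Hrho|].
replace (y t / rho t) with (y0 * (1 - RInt load 0 t)) by lra; ring.
Qed.

Lemma solution_C1 (y : R -> R) : is_solution tau l y0 y -> C1_on_positive y.
Proof.
intros Hy t Ht; split; [now apply (proj1 (proj2 Hy))|].
apply continuous_ext_loc with (fun s => - (y0 * l s + y s * / tau s)).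
- apply (filter_imp (fun s => 0 < s)); [|exact (open_gt 0 t Ht)].
  intros s Hs; symmetry; now apply Derive_solution.
- apply (continuous_opp (V := R_NormedModule)
      (fun s => y0 * l s + y s * / tau s)).
  apply (continuous_plus (V := R_NormedModule)
      (fun s => y0 * l s) (fun s => y s * / tau s)).
  + apply (continuous_mult (K := R_AbsRing) (fun _ => y0) l);
      [apply continuous_const|].
    now apply continuous_of_half_line.
  + apply (continuous_mult (K := R_AbsRing) y (fun s => / tau s)).
    * apply continuous_of_half_line; [exact (proj1 Hy)|exact Ht].
    * apply (continuous_comp tau (fun x => / x)).
      -- now apply continuous_of_half_line.
      -- apply continuous_Rinv, Rgt_not_eq, tau_pos; lra.
Qed.

Lemma Derive_solution_explicit (y : R -> R) (t : R) :
  is_solution tau l y0 y -> 0 < t ->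
  Derive y t =
  - (y0 * (l t + / tau t * relaxation tau t * (1 - RInt load 0 t))).
Proof.
intros Hy Ht.
rewrite (Derive_solution y t Hy Ht), (solution_eq_explicit y t Hy) by lra.
unfold explicit_solution, load, Rdiv; ring.
Qed.

End VariationOfConstants.

(** * Functions with prescribed support *)

Lemma zero_outside_support (f : R -> R) (t : R) :
  0 <= t -> ~ support f t -> f t = 0.
Proof.
intros Ht Hs; destruct (Req_dec (f t) 0) as [E|E]; [exact E|].
exfalso; apply Hs, (adherence_P1 (fun t => nonneg_half_line t /\ f t <> 0)).
now split.
Qed.

(** [T] itself belongs to the support; the vanishing comes from the right,
    where [f] is zero because the support has ended. *)
Lemma zero_at_support_end (f : R -> R) (T : R) :
  0 < T -> continuous_on nonneg_half_line f ->
  eq_Dom (support f) (fun t => 0 <= t <= T) -> f T = 0.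
Proof.
intros HT Hf [Hsup _].
destruct (Req_dec (f T) 0) as [E|E]; [exact E|exfalso].
assert (L : locally T (fun s => f s <> 0)).
{ apply (continuous_of_half_line f T Hf HT (fun x => x <> 0)).
  exact (open_neq 0 (f T) E). }
destruct L as [d Hd].
pose proof (cond_pos d) as Hdp.
apply (Hd (T + d / 2)).
- change (Rabs (T + d / 2 - T) < d).
  rewrite Rabs_pos_eq; lra.
- apply zero_outside_support; [lra|].
  intros H; apply Hsup in H; lra.
Qed.

(** Continuity forces [f T = 0], and a nonincreasing function tending to [0]
    at [T] is nonnegative before [T].  A zero at an interior point would then
    propagate to the right up to [T], and the points in between would lie off
    the support. *)
Lemma pos_of_nonincreasing_support (f : R -> R) (T : R) :
  0 < T -> continuous_on nonneg_half_line f ->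
  eq_Dom (support f) (fun t => 0 <= t <= T) ->
  nonincreasing_on (fun t => 0 < t < T) f ->
  forall t, 0 < t < T -> 0 < f t.
Proof.
intros HT Hf Hsup Hmono.
assert (HfT := zero_at_support_end f T HT Hf Hsup).
assert (Hge : forall t, 0 < t < T -> 0 <= f t).
{ intros t Ht; apply Rnot_lt_le; intros Hneg.
  assert (L : locally T (fun s => f t < f s)).
  { apply (continuous_of_half_line f T Hf HT (fun x => f t < x)).
    apply (open_gt (f t) (f T)); lra. }
  destruct L as [d Hd]; pose proof (cond_pos d) as Hdp.
  set (s := Rmax t (T - d / 2)).
  assert (Hs1 : t <= s) by apply Rmax_l.
  assert (Hs2 : T - d / 2 <= s) by apply Rmax_r.
  assert (Hs3 : s < T) by (apply Rmax_lub_lt; lra).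
  assert (f s <= f t) by (apply Hmono; lra).
  assert (f t < f s); [|lra].
  apply Hd; change (Rabs (s - T) < d); apply Rabs_def1; lra. }
intros t Ht; destruct (Hge t Ht) as [H|H]; [exact H|exfalso].
(* The midpoint of [(t, T)] has the whole interval as a neighbourhood, so
   the support meets that interval. *)
assert (Hin : support f ((t + T) / 2)) by (apply Hsup; lra).
assert (Hr : 0 < (T - t) / 2) by lra.
destruct (Hin (disc ((t + T) / 2) (mkposreal _ Hr))) as [s [Hs [_ Hs0]]].
- now exists (mkposreal _ Hr).
- unfold disc in Hs; simpl in Hs; apply Rabs_def2 in Hs.
  apply Hs0, Rle_antisym; [rewrite H; apply Hmono|apply Hge]; lra.
Qed.

(** * Decay of the kinetic energy *)

Section Decay.

Variables (T y0 : R) (tau l y : R -> R).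
Hypothesis T_pos : 0 < T.
Hypothesis y0_pos : 0 < y0.
Hypothesis tau_pos : forall t : R, 0 <= t -> 0 < tau t.
Hypothesis tau_cont : continuous_on nonneg_half_line tau.
Hypothesis l_cont : continuous_on nonneg_half_line l.
Hypothesis l_support : eq_Dom (support l) (fun t => 0 <= t <= T).
Hypothesis load_total : RInt (fun s => l s / relaxation tau s) 0 T = 1.
Hypothesis y_solution : is_solution tau l y0 y.

Lemma Derive_solution_end : Derive y T = 0.
Proof.
rewrite (Derive_solution_explicit tau l y0 tau_pos tau_cont l_cont y T
           y_solution T_pos), load_total.
rewrite (zero_at_support_end l T T_pos l_cont l_support); ring.
Qed.

Lemma energy_vanishes_at_end (c : R) :
  filterlim (kinetic_energy c y) (at_left T) (locally 0).
Proof.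
assert (Hc : continuous (kinetic_energy c y) T).
{ destruct (solution_C1 tau l y0 tau_pos tau_cont l_cont y y_solution T T_pos)
    as [_ Hd].
  apply (continuous_mult (K := R_AbsRing)
      (fun _ => c) (fun t => Derive y t ^ 2));
    [apply continuous_const|].
  apply (continuous_mult (K := R_AbsRing) (Derive y) (fun t => Derive y t * 1));
    [exact Hd|].
  apply (continuous_mult (K := R_AbsRing) (Derive y) (fun _ => 1)); [exact Hd|].
  apply continuous_const. }
unfold continuous in Hc.
replace (kinetic_energy c y T) with 0 in Hc
  by (unfold kinetic_energy; rewrite Derive_solution_end; ring).
apply (filterlim_filter_le_1 (F := locally T));
  [apply filter_le_within|exact Hc].
Qed.

Hypothesis l_mono : nonincreasing_on (fun t => 0 < t < T) l.
Hypothesis rate_mono :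
  nonincreasing_on (fun t => 0 < t < T) (fun t => / tau t * relaxation tau t).

Lemma energy_strictly_decreasing (c : R) :
  0 < c -> strictly_decreasing_on (fun t => 0 < t < T) (kinetic_energy c y).
Proof.
intros Hc s t Hs Ht Hst.
assert (Hl := pos_of_nonincreasing_support l T T_pos l_cont l_support l_mono).
set (load := fun s => l s / relaxation tau s).
assert (Hload : forall a b, 0 < a < b -> b <= T ->
          RInt load 0 a < RInt load 0 b).
{ intros a b Hab HbT; apply RInt_lt_of_pos; [|exact Hab|].
  - now apply continuous_on_load.
  - intros x Hx; apply Rdiv_lt_0_compat; [apply Hl; lra|apply relaxation_pos]. }
assert (H1 : RInt load 0 s < RInt load 0 t) by (apply Hload; lra).
assert (H2 : RInt load 0 t < 1).
{ rewrite <- load_total; apply Hload; lra. }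
assert (Hls : l t <= l s) by (apply l_mono; auto; lra).
assert (Hr : / tau t * relaxation tau t <= / tau s * relaxation tau s)
  by (apply rate_mono; auto; lra).
assert (Hrt : 0 < / tau t * relaxation tau t).
{ apply Rmult_lt_0_compat; [|apply relaxation_pos].
  apply Rinv_0_lt_compat, tau_pos; lra. }
assert (Hlt := Hl t Ht).
unfold kinetic_energy.
rewrite (Derive_solution_explicit tau l y0 tau_pos tau_cont l_cont y s
           y_solution) by lra.
rewrite (Derive_solution_explicit tau l y0 tau_pos tau_cont l_cont y t
           y_solution) by lra.
fold load.
set (q := / tau t * relaxation tau t) in *.
set (p := / tau s * relaxation tau s) in *.
assert (Hprod : q * (1 - RInt load 0 t) < p * (1 - RInt load 0 s)).
{ apply Rlt_le_trans with (q * (1 - RInt load 0 s)).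
  - apply Rmult_lt_compat_l; lra.
  - apply Rmult_le_compat_r; lra. }
assert (Hpos : 0 < q * (1 - RInt load 0 t)) by (apply Rmult_lt_0_compat; lra).
apply Rmult_lt_compat_l; [exact Hc|].
rewrite <- !Rsqr_pow2, <- !Rsqr_neg.
apply Rsqr_incrst_1.
- apply Rmult_lt_compat_l; lra.
- apply Rmult_le_pos; lra.
- apply Rmult_le_pos; lra.
Qed.

End Decay.

Theorem proposition3 :
  forall (T y0 : R) (tau l : R -> R),
    0 < T ->
    0 < y0 ->
    (forall t : R, 0 <= t -> 0 < tau t) ->
    continuous_on nonneg_half_line tau ->
    nonincreasing_on nonneg_half_line tau ->
    continuous_on nonneg_half_line l ->
    eq_Dom (support l) (fun t => 0 <= t <= T) ->
    RInt (fun s => l s / relaxation tau s) 0 T = 1 ->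
    (exists y : R -> R, is_solution tau l y0 y) /\
    (forall y z : R -> R,
       is_solution tau l y0 y -> is_solution tau l y0 z ->
       forall t : R, 0 <= t -> y t = z t) /\
    (forall y : R -> R,
       is_solution tau l y0 y ->
       C1_on_positive y /\
       (forall t : R, 0 <= t <= T ->
          y t = y0 * relaxation tau t *
                (1 - RInt (fun s => l s / relaxation tau s) 0 t)) /\
       (nonincreasing_on (fun t => 0 < t < T) l ->
        nonincreasing_on (fun t => 0 < t < T)
          (fun t => / tau t * relaxation tau t) ->
        forall c : R, 0 < c ->
          strictly_decreasing_on (fun t => 0 < t < T) (kinetic_energy c y) /\
          filterlim (kinetic_energy c y) (at_left T) (locally 0))).
Proof.
intros T y0 tau l HT Hy0 Htau Htc _ Hlc Hsup Hint.
split; [|split].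
- exists (explicit_solution tau l y0); now apply explicit_solution_correct.
- intros y z Hy Hz t Ht.
  rewrite (solution_eq_explicit tau l y0 Htau Htc Hlc y t Hy Ht).
  now rewrite (solution_eq_explicit tau l y0 Htau Htc Hlc z t Hz Ht).
- intros y Hy; split; [|split].
  + exact (solution_C1 tau l y0 Htau Htc Hlc y Hy).
  + intros t Ht; apply (solution_eq_explicit tau l y0 Htau Htc Hlc y t Hy); lra.
  + intros Hl Hr c Hc; split.
    * now apply (energy_strictly_decreasing T y0 tau l).
    * now apply (energy_vanishes_at_end T y0 tau l).
Qed.
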